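(* Let $\rho:B_\infty\to GL(n,\mathbb{C})$ be a finite dimensional complex representation of the stable braid group. If the restriction of $\rho$ to some $B_m$ is an irreducible representation of dimension at least $2$, then $\rho$ is the trivial representation. Thus the induced map in complex $K$-theory is also trivial. Furthermore, if $\rho$ is any unitary representation, then $\rho$ factors through $\mathbb{Z}$, the abelianization of $B_\infty$, and the induced element in complex $K$-theory is also trivial.
   Context: $B_m$ is Artin's braid group on $m$ strands and $B_\infty=\varinjlim_m B_m$ is the stable braid group, the direct limit under the standard inclusions $B_m\subset B_{m+1}$. The element in (reduced) complex $K$-theory $KU^0(BB_\infty)=[BB_\infty,BU]$ induced by $\rho$ is the class of $BB_\infty\to BGL(n,\mathbb{C})\simeq BU(n)\to BU$. *)

(* Defs.v *)
From HB Require Import structures.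
From mathcomp Require Import all_boot all_order all_algebra generic_quotient.
From mathcomp Require Import spectral complex.
From mathcomp Require Import all_classical all_reals all_analysis.

Set Implicit Arguments.
Unset Strict Implicit.
Unset Printing Implicit Defensive.

Import Order.TTheory GRing.Theory Num.Theory.
Import numFieldNormedType.Exports.

Local Open Scope classical_set_scope.
Local Open Scope ring_scope.
Local Open Scope quotient_scope.

(* The braid group on m strands has generators indexed by 'I_m.-1.  A word is a
   list of letters: (false, i) is the i-th generator, (true, i) its inverse. *)
Definition braid_word (m : nat) : Type := seq (bool * 'I_m.-1).
HB.instance Definition _ m := Choice.on (braid_word m).

Section ArtinRelations.
Variable m : nat.

Let sigma (i : 'I_m.-1) : bool * 'I_m.-1 := (false, i).

Inductive artin_eq : braid_word m -> braid_word m -> Prop :=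
| artin_refl u : artin_eq u u
| artin_sym u v : artin_eq u v -> artin_eq v u
| artin_trans u v w : artin_eq u v -> artin_eq v w -> artin_eq u w
| artin_cat u u' v v' :
    artin_eq u u' -> artin_eq v v' -> artin_eq (u ++ v) (u' ++ v')
| artin_cancel e i : artin_eq [:: (e, i); (~~ e, i)] [::]
| artin_far (i j : 'I_m.-1) : (i.+1 < j)%N ->
    artin_eq [:: sigma i; sigma j] [:: sigma j; sigma i]
| artin_braid (i j : 'I_m.-1) : j = i.+1 :> nat ->
    artin_eq [:: sigma i; sigma j; sigma i] [:: sigma j; sigma i; sigma j].

Definition artin_rel (u v : braid_word m) : bool := `[< artin_eq u v >].

Lemma artin_rel_equiv : equiv_class_of artin_rel.
Proof.
split=> [u|u v|v u w]; first by apply/asboolP; exact: artin_refl.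
- by apply/asboolP/asboolP; exact: artin_sym.
- by move=> /asboolP uv /asboolP vw; apply/asboolP; exact: artin_trans uv vw.
Qed.

Canonical artin_equiv := EquivRelPack artin_rel_equiv.

Definition braid : Type := {eq_quot artin_equiv}.
HB.instance Definition _ := Choice.on braid.

Definition braid_of (u : braid_word m) : braid := \pi_{eq_quot artin_equiv} u.

Lemma braid_ofP u v : braid_of u = braid_of v <-> artin_eq u v.
Proof. by rewrite /braid_of; split=> [/eqquotP/asboolP|?] //; apply/eqquotP/asboolP. Qed.

Lemma braid_of_surj (x : braid) : exists u, x = braid_of u.
Proof. by exists (repr x); rewrite /braid_of reprK. Qed.

Definition word_inv (u : braid_word m) : braid_word m :=
  rev [seq (~~ a.1, a.2) | a <- u].

Lemma word_inv_cat u v : word_inv (u ++ v) = word_inv v ++ word_inv u.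
Proof. by rewrite /word_inv map_cat rev_cat. Qed.

Lemma word_invK : involutive word_inv.
Proof.
move=> u; rewrite /word_inv map_rev revK -map_comp -[RHS]map_id.
by apply: eq_map => -[e i] /=; rewrite negbK.
Qed.

Lemma artin_mulV u : artin_eq (u ++ word_inv u) [::].
Proof.
elim: u => [|[e i] u IHu]; first exact: artin_refl.
rewrite -cat1s word_inv_cat catA -[(_ ++ u) ++ _]catA.
apply: (@artin_trans _ (([:: (e, i)] ++ [::]) ++ word_inv [:: (e, i)])).
  apply: artin_cat; last exact: artin_refl.
  by apply: artin_cat => //; exact: artin_refl.
exact: artin_cancel.
Qed.

Lemma artin_mulI u v w : artin_eq u v -> artin_eq (w ++ u) (w ++ v).
Proof. by apply: artin_cat; exact: artin_refl. Qed.

Lemma artin_mulIr u v w : artin_eq u v -> artin_eq (u ++ w) (v ++ w).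
Proof. by move=> /artin_cat; apply; exact: artin_refl. Qed.

Lemma artin_inv u v : artin_eq u v -> artin_eq (word_inv u) (word_inv v).
Proof.
move=> uv.
have Vv : artin_eq (v ++ word_inv u) [::].
  apply: artin_trans (artin_mulV u).
  by apply: artin_mulIr; exact: artin_sym.
have /(artin_mulI (word_inv v)) := Vv; rewrite cats0 catA => H.
apply: artin_trans H; apply: artin_sym.
rewrite -[X in artin_eq _ X]cat0s; apply: artin_mulIr.
by rewrite -{2}[v]word_invK; exact: artin_mulV.
Qed.

Definition braid_mul (x y : braid) : braid := braid_of (repr x ++ repr y).
Definition braid_inv (x : braid) : braid := braid_of (word_inv (repr x)).

Lemma artin_repr u : artin_eq (repr (braid_of u)) u.
Proof. by apply/braid_ofP; rewrite /braid_of reprK. Qed.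

Lemma braid_mulE u v : braid_mul (braid_of u) (braid_of v) = braid_of (u ++ v).
Proof. by apply/braid_ofP; apply: artin_cat; exact: artin_repr. Qed.

Lemma braid_invE u : braid_inv (braid_of u) = braid_of (word_inv u).
Proof. by apply/braid_ofP; apply: artin_inv; exact: artin_repr. Qed.

Lemma braid_mulA : associative braid_mul.
Proof.
move=> x y z; have [u ->] := braid_of_surj x; have [v ->] := braid_of_surj y.
by have [w ->] := braid_of_surj z; rewrite !braid_mulE catA.
Qed.

Lemma braid_mul1 : left_id (braid_of [::]) braid_mul.
Proof. by move=> x; have [u ->] := braid_of_surj x; rewrite braid_mulE. Qed.

Lemma braid_mulr1 : right_id (braid_of [::]) braid_mul.
Proof. by move=> x; have [u ->] := braid_of_surj x; rewrite braid_mulE cats0. Qed.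

Lemma braid_mulV : left_inverse (braid_of [::]) braid_inv braid_mul.
Proof.
move=> x; have [u ->] := braid_of_surj x; rewrite braid_invE braid_mulE.
by apply/braid_ofP; rewrite -{2}[u]word_invK; exact: artin_mulV.
Qed.

Lemma braid_mulrV : right_inverse (braid_of [::]) braid_inv braid_mul.
Proof.
move=> x; have [u ->] := braid_of_surj x; rewrite braid_invE braid_mulE.
by apply/braid_ofP; exact: artin_mulV.
Qed.

HB.instance Definition _ := isGroup.Build braid
  braid_mulA braid_mul1 braid_mulr1 braid_mulV braid_mulrV.

End ArtinRelations.

Definition word_incl m (u : braid_word m) : braid_word m.+1 :=
  [seq (a.1, widen_ord (leq_pred m) a.2) | a <- u].

Lemma artin_incl m (u v : braid_word m) :
  artin_eq u v -> artin_eq (word_incl u) (word_incl v).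
Proof.
elim=> {u v}.
- by move=> u; exact: artin_refl.
- by move=> u v _; exact: artin_sym.
- by move=> u v w _ uv _; exact: artin_trans.
- by move=> u u' v v' _ uu' _ vv'; rewrite /word_incl !map_cat; exact: artin_cat.
- by move=> e i; exact: artin_cancel.
- by move=> i j ij; exact: artin_far.
- by move=> i j ij; exact: artin_braid.
Qed.

Definition braid_incl m (x : braid m) : braid m.+1 :=
  braid_of (word_incl (repr x)).

Lemma braid_inclE m (u : braid_word m) :
  braid_incl (braid_of u) = braid_of (word_incl u).
Proof. by apply/braid_ofP/artin_incl; exact: artin_repr. Qed.

Lemma braid_inclM m : {morph @braid_incl m : x y / (x * y)%g}.
Proof.
move=> x y; have [u ->] := braid_of_surj x; have [v ->] := braid_of_surj y.
rewrite [(_ * _)%g]braid_mulE !braid_inclE [(_ * _)%g in RHS]braid_mulE.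
by rewrite /word_incl map_cat.
Qed.

HB.instance Definition _ m :=
  isMultiplicative.Build (braid m) (braid m.+1) (@braid_incl m) (@braid_inclM m).

Section SeqColimit.
Variables (T : nat -> choiceType) (f : forall n, T n -> T n.+1).

Definition colim_step (u : {n & T n}) : {n & T n} :=
  existT T (tag u).+1 (f (tagged u)).

Definition colim_rel (u v : {n & T n}) : bool :=
  `[< exists i j, iter i colim_step u = iter j colim_step v >].

Lemma colim_rel_equiv : equiv_class_of colim_rel.
Proof.
split=> [u|u v|v u w].
- by apply/asboolP; exists 0, 0.
- by apply/asboolP/asboolP => -[i [j ij]]; exists j, i.
- move=> /asboolP[i [j ij]] /asboolP[k [l kl]]; apply/asboolP.
  by exists (k + i)%N, (j + l)%N; rewrite !iterD ij -kl -!iterD addnC.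
Qed.

Canonical colim_equiv := EquivRelPack colim_rel_equiv.

Definition seqcolim : Type := {eq_quot colim_equiv}.
HB.instance Definition _ := Choice.on seqcolim.

Definition colim_in n (a : T n) : seqcolim :=
  \pi_{eq_quot colim_equiv} (existT T n a).

Lemma colim_inP n m (a : T n) (b : T m) : colim_in a = colim_in b <->
  exists i j, iter i colim_step (existT T n a) = iter j colim_step (existT T m b).
Proof. by rewrite /colim_in; split=> [/eqquotP/asboolP|?] //; apply/eqquotP/asboolP. Qed.

Lemma colim_in_step n (a : T n) : colim_in (f a) = colim_in a.
Proof. by apply/colim_inP; exists 0, 1. Qed.

Lemma colim_in_iter n (a : T n) k :
  exists b : T (k + n), colim_in a = colim_in b.
Proof.
elim: k => [|k [b ->]]; first by exists a.
by exists (f b); rewrite colim_in_step.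
Qed.

Lemma colim_in_surj (x : seqcolim) : exists n (a : T n), x = colim_in a.
Proof.
exists (tag (repr x)), (tagged (repr x)).
by rewrite /colim_in; case: (repr x) (reprK x) => n a /= ->.
Qed.

Lemma colim_in_surj2 (x y : seqcolim) :
  exists n (a b : T n), x = colim_in a /\ y = colim_in b.
Proof.
have [n [a ->]] := colim_in_surj x; have [m [b ->]] := colim_in_surj y.
have [a' ->] := colim_in_iter a m; have [b' ->] := colim_in_iter b n.
by exists (m + n)%N, a'; move: b'; rewrite [(n + m)%N]addnC => b'; exists b'.
Qed.

Lemma colim_in_surj3 (x y z : seqcolim) : exists n (a b c : T n),
  [/\ x = colim_in a, y = colim_in b & z = colim_in c].
Proof.
have [n [a [b [-> ->]]]] := colim_in_surj2 x y.
have [m [c ->]] := colim_in_surj z.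
have [a' ->] := colim_in_iter a m; have [b' ->] := colim_in_iter b m.
have [c' ->] := colim_in_iter c n.
exists (m + n)%N, a', b'.
by move: c'; rewrite [(n + m)%N]addnC => c'; exists c'.
Qed.

End SeqColimit.

Section GroupColimit.
Variables (G : nat -> groupType) (f : forall n, {multiplicative G n -> G n.+1}).

Definition group_colim : Type := seqcolim (fun n => f n).
HB.instance Definition _ := Choice.on group_colim.

Definition group_colim_in n (a : G n) : group_colim :=
  colim_in (fun n => f n) a.
Local Notation gin := group_colim_in.

Lemma colim_step_iterM n (a b : G n) k : exists N (a' b' : G N),
  [/\ iter k (colim_step (fun n => f n)) (existT _ n a) = existT _ N a',
      iter k (colim_step (fun n => f n)) (existT _ n b) = existT _ N b' &
      iter k (colim_step (fun n => f n)) (existT _ n (a * b)%g)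
        = existT _ N (a' * b')%g].
Proof.
elim: k => [|k [N [a' [b' [Ea Eb Eab]]]]]; first by exists n, a, b.
exists N.+1, (f N a'), (f N b').
by rewrite !iterS Ea Eb Eab /colim_step /= gmulfM.
Qed.

Lemma group_colim_in_mul n m (a b : G n) (a' b' : G m) :
  gin a = gin a' -> gin b = gin b' -> gin (a * b)%g = gin (a' * b')%g.
Proof.
move=> /colim_inP[i [j Ea]] /colim_inP[i' [j' Eb]].
pose st := colim_step (fun n => f n).
have tag_iter k p (c : G p) : tag (iter k st (existT _ p c)) = (k + p)%N.
  by elim: k => //= k ->.
have := congr1 (@tag _ _) Ea; have := congr1 (@tag _ _) Eb.
rewrite !tag_iter => Tb Ta.
have Eij : (i + j' = i' + j)%N.
  apply/eqP; rewrite -(eqn_add2r (n + m)) addnACA Ta -Tb.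
  by rewrite [X in _ == X]addnACA addnC eqxx.
have {}Ea : iter (i + i') st (existT _ n a) = iter (i + j') st (existT _ m a').
  by rewrite addnC iterD Ea -iterD Eij.
have {}Eb : iter (i + i') st (existT _ n b) = iter (i + j') st (existT _ m b').
  by rewrite iterD Eb -iterD.
apply/colim_inP; exists (i + i')%N, (i + j')%N.
have [N [a1 [b1 [Ea1 Eb1 ->]]]] := colim_step_iterM a b (i + i').
have [N' [a2 [b2 [Ea2 Eb2 ->]]]] := colim_step_iterM a' b' (i + j').
move: Ea Eb; rewrite /st Ea1 Eb1 Ea2 Eb2 => Ea Eb.
have NN := congr1 (@tag _ _) Ea; move: NN => /= NN.
move: a2 b2 Ea Eb {Ea2 Eb2}; rewrite -NN => a2 b2 Ea Eb.
have -> : a1 = a2 by exact: eq_from_Tagged Ea.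
by have -> : b1 = b2 by exact: eq_from_Tagged Eb.
Qed.

Definition group_colim_one : group_colim := gin (1 : G 0)%g.

Lemma group_colim_in1 n : gin (1 : G n)%g = group_colim_one.
Proof.
elim: n => [//|n <-].
rewrite -[gin (1 : G n)%g](colim_in_step (fun n => f n)); congr gin.
by apply: (@mulgI _ (f n 1%g)); rewrite -gmulfM !mulg1.
Qed.

Definition group_colim_mul (x y : group_colim) : group_colim :=
  xget group_colim_one
    [set z | exists n (a b : G n), [/\ x = gin a, y = gin b & z = gin (a * b)%g]].

Definition group_colim_inv (x : group_colim) : group_colim :=
  xget group_colim_one [set z | group_colim_mul z x = group_colim_one].

Lemma group_colim_mulE n (a b : G n) :
  group_colim_mul (gin a) (gin b) = gin (a * b)%g.
Proof.
rewrite /group_colim_mul; case: xgetP => [z _ [m [a' [b' [Ea Eb ->]]]]|].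
  by apply: group_colim_in_mul.
by move=> /(_ (gin (a * b)%g)) /=; case; exists n, a, b.
Qed.

Lemma group_colim_mulA : associative group_colim_mul.
Proof.
move=> x y z; have [n [a [b [c [-> -> ->]]]]] := colim_in_surj3 x y z.
by rewrite -?/(gin _) !group_colim_mulE mulgA.
Qed.

Lemma group_colim_mul1 : left_id group_colim_one group_colim_mul.
Proof.
move=> x; have [n [a ->]] := colim_in_surj x.
by rewrite -?/(gin _) -(group_colim_in1 n) group_colim_mulE mul1g.
Qed.

Lemma group_colim_mulr1 : right_id group_colim_one group_colim_mul.
Proof.
move=> x; have [n [a ->]] := colim_in_surj x.
by rewrite -?/(gin _) -(group_colim_in1 n) group_colim_mulE mulg1.
Qed.

Lemma group_colim_invE n (a : G n) : group_colim_inv (gin a) = gin a^-1%g.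
Proof.
rewrite /group_colim_inv; case: xgetP => [z _ /= Ez|].
  rewrite -[z]group_colim_mulr1 -(group_colim_in1 n) -(mulgV a).
  by rewrite -group_colim_mulE group_colim_mulA Ez group_colim_mul1.
by move=> /(_ (gin a^-1%g)) []; rewrite /= group_colim_mulE mulVg group_colim_in1.
Qed.

Lemma group_colim_mulV :
  left_inverse group_colim_one group_colim_inv group_colim_mul.
Proof.
move=> x; have [n [a ->]] := colim_in_surj x; rewrite -?/(gin _).
by rewrite group_colim_invE group_colim_mulE mulVg group_colim_in1.
Qed.

Lemma group_colim_mulrV :
  right_inverse group_colim_one group_colim_inv group_colim_mul.
Proof.
move=> x; have [n [a ->]] := colim_in_surj x; rewrite -?/(gin _).
by rewrite group_colim_invE group_colim_mulE mulgV group_colim_in1.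
Qed.

HB.instance Definition _ := isGroup.Build group_colim group_colim_mulA
  group_colim_mul1 group_colim_mulr1 group_colim_mulV group_colim_mulrV.

End GroupColimit.

Definition braid_incl_hom m : {multiplicative braid m -> braid m.+1} :=
  @braid_incl m.

Definition stable_braid : Type := group_colim braid_incl_hom.
HB.instance Definition _ := Group.on stable_braid.
HB.instance Definition _ :=
  DiscreteTopology.copy stable_braid (discrete_topology stable_braid).

Definition stable_braid_in m (x : braid m) : stable_braid :=
  group_colim_in braid_incl_hom x.

Inductive commutator_subgroup (G : groupType) : G -> Prop :=
| commutator_comm x y : commutator_subgroup [~ x, y]%g
| commutator_one : commutator_subgroup 1%g
| commutator_mul x y : commutator_subgroup x -> commutator_subgroup y ->
    commutator_subgroup (x * y)%g
| commutator_inv x : commutator_subgroup x -> commutator_subgroup x^-1%g.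

(* The additive group A, via q, is the quotient of G by its commutator
   subgroup. *)
Definition is_abelianization (G : groupType) (A : zmodType) (q : G -> A) : Prop :=
  [/\ forall x y, q (x * y)%g = q x + q y,
      forall a, exists x, q x = a &
      forall x, q x = 0 <-> commutator_subgroup x].

Section LinearGroups.
Variables (C : numClosedFieldType) (n : nat).

Record GL : Type := MkGL { GLmx :> 'M[C]_n; GLmxP : GLmx \in unitmx }.
HB.instance Definition _ := [isSub for GLmx].
HB.instance Definition _ := [Choice of GL by <:].
HB.instance Definition _ := Topological.copy GL (initial_topology GLmx).

Lemma GL_mulP (A B : GL) : A *m B \in unitmx.
Proof. by rewrite unitmx_mul !GLmxP. Qed.

Lemma GL_invP (A : GL) : invmx A \in unitmx.
Proof. by rewrite unitmx_inv GLmxP. Qed.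

Definition GL_mul (A B : GL) : GL := MkGL (GL_mulP A B).
Definition GL_inv (A : GL) : GL := MkGL (GL_invP A).
Definition GL_one : GL := MkGL (unitmx1 C n).

Lemma GL_mulA : associative GL_mul.
Proof. by move=> A B D; apply/val_inj; rewrite /= mulmxA. Qed.
Lemma GL_mul1 : left_id GL_one GL_mul.
Proof. by move=> A; apply/val_inj; rewrite /= mul1mx. Qed.
Lemma GL_mulr1 : right_id GL_one GL_mul.
Proof. by move=> A; apply/val_inj; rewrite /= mulmx1. Qed.
Lemma GL_mulV : left_inverse GL_one GL_inv GL_mul.
Proof. by move=> A; apply/val_inj; rewrite /= mulVmx ?GLmxP. Qed.
Lemma GL_mulrV : right_inverse GL_one GL_inv GL_mul.
Proof. by move=> A; apply/val_inj; rewrite /= mulmxV ?GLmxP. Qed.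

HB.instance Definition _ :=
  isGroup.Build GL GL_mulA GL_mul1 GL_mulr1 GL_mulV GL_mulrV.

Record U : Type := MkU { Umx :> 'M[C]_n; UmxP : Umx \is unitarymx }.
HB.instance Definition _ := [isSub for Umx].
HB.instance Definition _ := [Choice of U by <:].
HB.instance Definition _ := Topological.copy U (initial_topology Umx).

Lemma U_mulP (A B : U) : A *m B \is unitarymx.
Proof. by rewrite mul_unitarymx ?UmxP. Qed.

Lemma U_invP (A : U) : invmx A \is unitarymx.
Proof. by rewrite invmx_unitary ?trmxC_unitary UmxP. Qed.

Lemma U_oneP : (1%:M : 'M[C]_n) \is unitarymx.
Proof. by apply/unitarymxP; rewrite trmx1 map_mx1 mulmx1. Qed.

Definition U_mul (A B : U) : U := MkU (U_mulP A B).
Definition U_inv (A : U) : U := MkU (U_invP A).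
Definition U_one : U := MkU U_oneP.

Lemma U_mulA : associative U_mul.
Proof. by move=> A B D; apply/val_inj; rewrite /= mulmxA. Qed.
Lemma U_mul1 : left_id U_one U_mul.
Proof. by move=> A; apply/val_inj; rewrite /= mul1mx. Qed.
Lemma U_mulr1 : right_id U_one U_mul.
Proof. by move=> A; apply/val_inj; rewrite /= mulmx1. Qed.
Lemma U_mulV : left_inverse U_one U_inv U_mul.
Proof. by move=> A; apply/val_inj; rewrite /= mulVmx ?unitarymx_unit ?UmxP. Qed.
Lemma U_mulrV : right_inverse U_one U_inv U_mul.
Proof. by move=> A; apply/val_inj; rewrite /= mulmxV ?unitarymx_unit ?UmxP. Qed.

HB.instance Definition _ :=
  isGroup.Build U U_mulA U_mul1 U_mulr1 U_mulV U_mulrV.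

Definition U_GL (A : U) : GL := MkGL (unitarymx_unit (UmxP A)).

Lemma U_GLM : {morph U_GL : A B / (A * B)%g}.
Proof. by move=> A B; apply/val_inj. Qed.

HB.instance Definition _ := isMultiplicative.Build U GL U_GL U_GLM.

Definition irreducible_rep (G : Type) (rho : G -> GL) : Prop :=
  (0 < n)%N /\
  forall W : {vspace 'cV[C]_n},
    (forall g v, v \in W -> rho g *m v \in W) -> W = 0%VS \/ W = fullv.

Definition unitary_rep (G : Type) (rho : G -> GL) : Prop :=
  forall g, (rho g : 'M[C]_n) \is unitarymx.

End LinearGroups.

Section UnitaryStabilization.
Variables (C : numClosedFieldType) (n : nat).

Definition stab_mx (A : 'M[C]_n) : 'M[C]_n.+1 :=
  castmx (addn1 n, addn1 n) (block_mx A 0 0 (1%:M : 'M[C]_1)).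

Lemma stab_mxM (A B : 'M[C]_n) : stab_mx (A *m B) = stab_mx A *m stab_mx B.
Proof.
rewrite /stab_mx; case: _ / (addn1 n).
by rewrite !castmx_id mulmx_block !(mulmx0, mul0mx, addr0, add0r, mulmx1).
Qed.

Lemma stab_mxP (A : U C n) : stab_mx A \is unitarymx.
Proof.
apply/unitarymxP; rewrite /stab_mx; case: _ / (addn1 n).
rewrite !castmx_id tr_block_mx map_block_mx mulmx_block.
rewrite !(trmx0, map_mx0, mulmx0, mul0mx, addr0, add0r, mul1mx, trmx1, map_mx1).
by rewrite (unitarymxP (UmxP A)) -scalar_mx_block.
Qed.

Definition U_stab (A : U C n) : U C n.+1 := MkU (stab_mxP A).

Lemma U_stabM : {morph U_stab : A B / (A * B)%g}.
Proof. by move=> A B; apply/val_inj; exact: stab_mxM. Qed.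

HB.instance Definition _ :=
  isMultiplicative.Build (U C n) (U C n.+1) U_stab U_stabM.

End UnitaryStabilization.

(* A group carrying a topology.  Compatibility of the two is not needed to write
   down the classifying space; the groups used below are topological groups. *)
#[short(type="topGroupType")]
HB.structure Definition TopGroup := {G of Group G & Topological G}.

HB.instance Definition _ (C : numClosedFieldType) n := Group.on (GL C n).
HB.instance Definition _ (C : numClosedFieldType) n := Group.on (U C n).
HB.instance Definition _ := Group.on stable_braid.

(* Milnor's model of the classifying space of G.  A point of the infinite join
   EG = G * G * ... is a formal sum of t_i g_i, with barycentric coordinates t_i,
   where g_i only matters if t_i > 0; EG has the coarsest topology making
   t_i : EG -> [0, 1] and g_i : {t_i > 0} -> G continuous, and BG = EG / G for
   right translation of all the g_i.  Here the two identifications are made in a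
   single quotient. *)
Section ClassifyingSpace.
Variable R : realType.

Definition simplex_weights (t : nat -> R) : Prop :=
  (forall i, 0 <= t i) /\
  exists N, (forall i, (N <= i)%N -> t i = 0) /\ \sum_(i < N) t i = 1.

Section Space.
Variable G : topGroupType.

Record join_data : Type := JoinData {
  jweight : nat -> R;
  jlabel : nat -> G;
  jweightP : simplex_weights jweight }.

HB.instance Definition _ := gen_eqMixin join_data.
HB.instance Definition _ := gen_choiceMixin join_data.

Definition join_subbase : set (set join_data) :=
  [set A | (exists i (V : set R),
              open V /\ A = [set x | V (jweight x i)]) \/
           (exists i (V : set G),
              open V /\ A = [set x | 0 < jweight x i /\ V (jlabel x i)])].

HB.instance Definition _ :=
  isSubBaseTopological.Build join_data join_subbase id.

Definition classifying_rel (x y : join_data) : bool :=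
  `[< jweight x = jweight y /\
      exists g : G, forall i, 0 < jweight x i -> jlabel y i = (jlabel x i * g)%g >].

Lemma classifying_rel_equiv : equiv_class_of classifying_rel.
Proof.
have sym x y : classifying_rel x y -> classifying_rel y x.
  move=> /asboolP[w [g gP]]; apply/asboolP; split; first by [].
  by exists g^-1%g => i; rewrite -w => /gP ->; rewrite mulgK.
split=> [x|x y|y x z]; first by apply/asboolP; split=> //; exists 1%g => i _; rewrite mulg1.
  by apply/idP/idP; exact: sym.
move=> /asboolP[w [g gP]] /asboolP[w' [h hP]]; apply/asboolP.
split; first by rewrite w.
by exists (g * h)%g => i wi; rewrite hP -?w // gP // mulgA.
Qed.

Canonical classifying_equiv := EquivRelPack classifying_rel_equiv.

Definition BG : Type := quotient_topology {eq_quot classifying_equiv}.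
HB.instance Definition _ := Topological.on BG.

Definition BG_pi (x : join_data) : BG := \pi_{eq_quot classifying_equiv} x.

Lemma BG_piP x y : BG_pi x = BG_pi y <-> classifying_rel x y.
Proof. by rewrite /BG_pi; split=> [/eqquotP|?] //; apply/eqquotP. Qed.

Lemma vertex_weightsP : simplex_weights (fun i => (i == 0)%:R : R).
Proof.
split=> [i|]; first exact: ler0n.
by exists 1%N; split=> [[|i]//|]; rewrite big_ord1.
Qed.

Definition BG_point : BG := BG_pi (JoinData (fun=> 1%g) vertex_weightsP).

End Space.

Section Functoriality.
Variables (G H : topGroupType) (f : {multiplicative G -> H}).

Definition join_map (x : join_data G) : join_data H :=
  JoinData (fun i => f (jlabel x i)) (jweightP x).

Definition BG_map (x : BG G) : BG H := BG_pi (join_map (repr x)).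

Lemma BG_mapE x : BG_map (BG_pi x) = BG_pi (join_map x).
Proof.
apply/BG_piP; have /BG_piP : BG_pi (repr (BG_pi x)) = BG_pi x.
  by rewrite /BG_pi reprK.
move=> /asboolP[w [g gP]]; apply/asboolP; split=> //.
by exists (f g) => i wi; rewrite /= gP // gmulfM.
Qed.

End Functoriality.
End ClassifyingSpace.

Arguments BG_point {R G}.

Section Homotopy.
Variable R : realType.

Definition homotopic (X Y : topologicalType) (f g : X -> Y) : Prop :=
  exists H : X * R -> Y,
    [/\ {within [set p : X * R | 0 <= p.2 <= 1], continuous H},
        forall x, H (x, 0) = f x & forall x, H (x, 1) = g x].

Definition homotopy_inverse (X Y : topologicalType) (f : X -> Y) (g : Y -> X) :
    Prop :=
  [/\ continuous g, homotopic (g \o f) id & homotopic (f \o g) id].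

End Homotopy.

(* BU is the union of the BU(n), with the colimit topology. *)
Section KTheory.
Variable R : realType.
Local Notation C := (R[i] : numClosedFieldType).

Definition BU_stab n : BG R (U C n) -> BG R (U C n.+1) :=
  BG_map (@U_stab C n).

Definition BU : Type := quotient_topology (seqcolim BU_stab).
HB.instance Definition _ := Topological.on BU.

Definition BU_in n (x : BG R (U C n)) : BU := colim_in BU_stab x.

Definition BU_point : BU := BU_in (BG_point : BG R (U C 0)).

(* The zero element of [X, BU] is the class of the constant map. *)
Definition KU_trivial (X : topologicalType) (f : X -> BU) : Prop :=
  homotopic R f (fun=> BU_point).

(* BG -> BGL(n, C) -> BU(n) -> BU, where r is the middle equivalence: a homotopy
   inverse of the map induced by the inclusion of U(n) in GL(n, C).  Two such r
   are homotopic, so the class of KU_map rho r in [BG, BU] depends on rho only. *)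
Definition KU_map (G : topGroupType) n (rho : {multiplicative G -> GL C n})
    (r : BG R (GL C n) -> BG R (U C n)) : BG R G -> BU :=
  @BU_in n \o r \o BG_map rho.

Definition KU_class_trivial (G : topGroupType) n
    (rho : {multiplicative G -> GL C n}) : Prop :=
  forall r : BG R (GL C n) -> BG R (U C n),
    homotopy_inverse R (BG_map (@U_GL C n)) r -> KU_trivial (KU_map rho r).

End KTheory.

(* Main.v *)
From HB Require Import structures.
Require Import Defs.
From mathcomp Require Import all_boot all_order all_algebra spectral complex.
From mathcomp Require Import generic_quotient finmap.
From mathcomp Require Import all_classical all_reals all_analysis.
Import Order.TTheory GRing.Theory Num.Theory numFieldNormedType.Exports.

Set Implicit Arguments.
Unset Strict Implicit.
Unset Printing Implicit Defensive.

Local Open Scope ring_scope.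

(** Write s_0, s_1, ... for the generators of the stable braid group. The matrices
    rho(s_k) live in a finite dimensional space, so for some K the first K of
    them span all of them. As s_{K+1} commutes with the first K generators,
    rho(s_{K+1}) commutes with every rho(s_k) ([central_sigma]). The braid
    relation makes all generators conjugate, so all the rho(s_k) are equal to a
    single matrix A, and the image of rho is abelian
    ([stable_braid_rep_commute]).

    For the first assertion, an eigenvector of A spans a line invariant under the
    whole image. An irreducible restriction to some finite braid group therefore
    has dimension one ([irreducible_rep_dim_le1]): no representation has an
    irreducible restriction of dimension at least two, and the assertion holds
    because its premises contradict each other.

    For the second one, the abelianization is the exponent sum e
    ([exponent_sum_abelianization]), and a homomorphism with abelian image factors
    through it ([abelian_hom_exponent_sum]), so that rho(x) = A^e(x). If rho is
    unitary, the spectral theorem puts A on a one-parameter group U of unitary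
    matrices, A = U(1) ([unitary_flow_through]). The homomorphisms
    x |-> U(s e(x)), for s in [0, 1], deform the trivial homomorphism into rho
    ([unitary_rep_deformation]). In Milnor's model such a path of homomorphisms
    induces a homotopy of maps between classifying spaces, by acting on the labels
    ([homotopic_BG_map]), and the map induced by the trivial homomorphism is
    contracted by moving the barycentric weights to one vertex
    ([BG_map_trivial]). The point needing care is that these formulas are given
    before passing to the quotient by the group: they descend because the
    quotient map onto the classifying space is open, so that its product with the
    time interval is still a quotient map ([continuous_BG_prod]). Pushing the
    homotopy into BU, and cancelling the homotopy inverse of BU(n) -> BGL(n)
    against the inclusion of U(n), gives the triviality of the class
    ([unitary_rep_KU_class_trivial]). *)

(** * Generators of the stable braid group *)

Section StableBraidGenerators.

Lemma stable_braid_in_mul m (x y : braid m) :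
  stable_braid_in (x * y)%g = (stable_braid_in x * stable_braid_in y)%g.
Proof. by symmetry; apply: group_colim_mulE. Qed.

Lemma stable_braid_in_one m : stable_braid_in (1 : braid m)%g = 1%g.
Proof. exact: group_colim_in1. Qed.

Lemma stable_braid_in_incl m (x : braid m) :
  stable_braid_in (braid_incl x) = stable_braid_in x.
Proof. exact: (colim_in_step (fun n => braid_incl_hom n)). Qed.

(** The generator is taken in the smallest braid group containing it; by
    [stable_braid_in_sigma] its image does not depend on that choice. *)
Definition stable_sigma (k : nat) : stable_braid :=
  @stable_braid_in k.+2 (braid_of [:: (false, ord_max : 'I_k.+2.-1)]).

Lemma stable_braid_in_sigma m (i : 'I_m.-1) :
  stable_braid_in (braid_of [:: (false, i)]) = stable_sigma i.
Proof.
elim: m i => [[]//|m IHm] i.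
have [im|] := ltnP i m.-1.
  rewrite -(IHm (Ordinal im)) -[RHS]stable_braid_in_incl braid_inclE.
  rewrite /word_incl /=.
  by have -> : widen_ord (leq_pred m) (Ordinal im) = i by exact: val_inj.
case: m i {IHm} => [[]//|m] i mi; have im : i = m :> nat.
  by apply/eqP; rewrite eqn_leq -ltnS ltn_ord mi.
by rewrite /stable_sigma im; have -> : i = ord_max by exact: val_inj.
Qed.

Lemma braid_of_cat m (u v : braid_word m) :
  braid_of (u ++ v) = (braid_of u * braid_of v)%g.
Proof. by symmetry; apply: braid_mulE. Qed.

Lemma braid_of_cons m (a : bool * 'I_m.-1) (u : braid_word m) :
  braid_of (a :: u) = (braid_of [:: a] * braid_of u)%g.
Proof. by rewrite -braid_of_cat. Qed.

Lemma braid_of_inv m (i : 'I_m.-1) :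
  braid_of [:: (true, i)] = (braid_of [:: (false, i)])^-1%g.
Proof.
apply: (@mulgI _ (braid_of [:: (false, i)])).
rewrite mulgV -braid_of_cons; apply/braid_ofP; exact: artin_cancel.
Qed.

Lemma stable_sigma_far i j : (i.+1 < j)%N ->
  commute (stable_sigma i) (stable_sigma j).
Proof.
move=> ij; have ij' : (i < j.+1)%N by rewrite ltnS; apply/ltnW/ltnW.
pose a : 'I_j.+2.-1 := Ordinal ij'; pose b : 'I_j.+2.-1 := ord_max.
rewrite /commute -(stable_braid_in_sigma a) -(stable_braid_in_sigma b).
rewrite -!stable_braid_in_mul -!braid_of_cons; congr stable_braid_in.
by apply/braid_ofP; apply: artin_far.
Qed.

Lemma stable_sigma_braid i :
  (stable_sigma i * stable_sigma i.+1 * stable_sigma i =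
   stable_sigma i.+1 * stable_sigma i * stable_sigma i.+1)%g.
Proof.
pose a : 'I_i.+3.-1 := Ordinal (leqnSn i.+1); pose b : 'I_i.+3.-1 := ord_max.
have /braid_ofP : artin_eq [:: (false, a); (false, b); (false, a)]
    [:: (false, b); (false, a); (false, b)] by exact: artin_braid.
rewrite !(braid_of_cons _ (_ :: _)) => /(congr1 (@stable_braid_in _)).
by rewrite !stable_braid_in_mul !stable_braid_in_sigma !mulgA.
Qed.

Lemma stable_braid_ind (P : stable_braid -> Prop) :
  P 1%g -> (forall x y, P x -> P y -> P (x * y)%g) ->
  (forall x, P x -> P x^-1%g) -> (forall k, P (stable_sigma k)) ->
  forall x, P x.
Proof.
move=> P1 PM PV Ps x.
have [m [y ->]] : exists m (y : braid m), x = stable_braid_in y.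
  exact: colim_in_surj.
have [u ->] := braid_of_surj y; elim: u => [|[e i] u IHu].
  by rewrite [stable_braid_in _]stable_braid_in_one.
rewrite braid_of_cons stable_braid_in_mul; apply: PM => //.
have Pi : P (stable_braid_in (braid_of [:: (false, i)])).
  by rewrite stable_braid_in_sigma.
case: e => //; rewrite braid_of_inv.
suff -> : stable_braid_in (braid_of [:: (false, i)])^-1%g =
   (stable_braid_in (braid_of [:: (false, i)]))^-1%g by apply: PV.
apply: (@mulIg _ (stable_braid_in (braid_of [:: (false, i)]))).
by rewrite mulVg -stable_braid_in_mul mulVg stable_braid_in_one.
Qed.

(** This is the braid relation read as s t s = t s t with s t moved to the
    other side: all generators are conjugate. *)
Lemma stable_sigma_conj k :
  stable_sigma k.+1 =
  (stable_sigma k ^ (stable_sigma k * stable_sigma k.+1)^-1)%g.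
Proof.
rewrite conjgE invgK mulgA stable_sigma_braid.
by rewrite -(mulgA (stable_sigma k.+1)) mulgK.
Qed.

End StableBraidGenerators.

(** * The exponent sum and the abelianization *)

Section ExponentSum.

Definition word_exponent m (u : braid_word m) : int :=
  \sum_(a <- u) (if a.1 then -1 else 1).

Lemma word_exponent_artin m (u v : braid_word m) :
  artin_eq u v -> word_exponent u = word_exponent v.
Proof.
rewrite /word_exponent; elim=> {u v} //.
- by move=> u v w _ -> _ ->.
- by move=> u u' v v' _ Eu _ Ev; rewrite !big_cat /= Eu Ev.
- by move=> [] i; rewrite !big_cons big_nil.
- by move=> i j _; rewrite !big_cons big_nil.
- by move=> i j _; rewrite !big_cons big_nil.
Qed.

(** The sum is computed on a representative of the colimit, then of the braid;
    [exponent_sumE] shows that any representing word gives the same value. *)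
Definition exponent_sum (x : stable_braid) : int :=
  word_exponent (repr (tagged (repr x))).

(** Each Artin relation equates words with the same exponent sum, and adding a
    strand does not alter the letters, so the sum survives both quotients. *)
Lemma exponent_sumE m (u : braid_word m) :
  exponent_sum (stable_braid_in (braid_of u)) = word_exponent u.
Proof.
pose st := colim_step (fun n => braid_incl_hom n).
pose ex (x : {n & braid n}) := word_exponent (repr (tagged x)).
have exE p (w : braid_word p) : ex (existT _ p (braid_of w)) = word_exponent w.
  exact/word_exponent_artin/artin_repr.
have ex_st x k : ex (iter k st x) = ex x.
  elim: k => //= k <-; case: (iter k st x) => p y.
  have [w ->] := braid_of_surj y.
  rewrite [st _](_ : _ = existT _ p.+1 (braid_of (word_incl w))); last first.
    by rewrite /st /colim_step /=; congr existT; exact: braid_inclE.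
  by rewrite !exE /word_exponent big_map.
(* Two representatives in the colimit agree after finitely many inclusions. *)
rewrite -exE /exponent_sum -/(ex (repr _)).
set x := stable_braid_in _.
have /colim_inP[i [j E]] :
    colim_in (fun n => braid_incl_hom n) (tagged (repr x)) = x.
  by rewrite /colim_in; case: (repr x) (reprK x).
rewrite -(ex_st (repr x) i) -(ex_st (existT _ m (braid_of u)) j) -E.
by case: (repr x).
Qed.

Lemma stable_braid_surj2 (x y : stable_braid) : exists m (u v : braid_word m),
  x = stable_braid_in (braid_of u) /\ y = stable_braid_in (braid_of v).
Proof.
have [m [a [b [-> ->]]]] := colim_in_surj2 x y.
have [u ->] := braid_of_surj a; have [v ->] := braid_of_surj b.
by exists m, u, v.
Qed.

Lemma exponent_sumM x y :
  exponent_sum (x * y)%g = exponent_sum x + exponent_sum y.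
Proof.
have [m [u [v [-> ->]]]] := stable_braid_surj2 x y.
rewrite -stable_braid_in_mul -braid_of_cat !exponent_sumE.
by rewrite /word_exponent big_cat.
Qed.

Lemma exponent_sum_sigma k : exponent_sum (stable_sigma k) = 1.
Proof. by rewrite exponent_sumE /word_exponent big_seq1. Qed.

Lemma exponent_sum1 : exponent_sum 1%g = 0.
Proof.
by apply: (@addIr _ (exponent_sum 1%g)); rewrite -exponent_sumM mulg1 add0r.
Qed.

Lemma exponent_sumV x : exponent_sum x^-1%g = - exponent_sum x.
Proof. by apply/eqP; rewrite -addr_eq0 -exponent_sumM mulVg exponent_sum1. Qed.

End ExponentSum.

Section GroupHomomorphisms.
Variables (G H : groupType) (f : {multiplicative G -> H}).

Lemma hom1 : f 1%g = 1%g.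
Proof. by apply: (@mulgI _ (f 1%g)); rewrite -gmulfM !mulg1. Qed.

Lemma homV x : f x^-1%g = (f x)^-1%g.
Proof. by apply: (@mulIg _ (f x)); rewrite -gmulfM !mulVg hom1. Qed.

Lemma homJ x y : f (x ^ y)%g = (f x ^ f y)%g.
Proof. by rewrite !conjgE !gmulfM homV. Qed.

(** A homomorphism with commuting values kills commutators: this is how an
    abelian image is turned into a factorization through the abelianization. *)
Lemma hom_commutator x :
  (forall x y, commute (f x) (f y)) -> commutator_subgroup x -> f x = 1%g.
Proof.
move=> cf; elim=> {x} [x y||x y _ fx _ fy|x _ fx].
- by rewrite /commg gmulfM homV homJ; apply/eqP/commgP.
- exact: hom1.
- by rewrite gmulfM fx fy mulg1.
- by rewrite homV fx invg1.
Qed.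

End GroupHomomorphisms.

Lemma commutator_conj (G : groupType) (x g : G) :
  commutator_subgroup x -> commutator_subgroup (x ^ g)%g.
Proof.
move=> Nx; rewrite -(mulVKg x (x ^ g)%g); apply: commutator_mul => //.
by rewrite -commgEl; exact: commutator_comm.
Qed.

(** Consecutive generators are conjugate, so their quotient is a commutator; the
    claim follows by telescoping down to the first generator. *)
Lemma stable_sigma_commutator k :
  commutator_subgroup (stable_sigma k * (stable_sigma 0)^-1)%g.
Proof.
elim: k => [|k IHk]; first by rewrite mulgV; exact: commutator_one.
rewrite -(divgKA (stable_sigma k)); apply: commutator_mul => //.
have -> : (stable_sigma k.+1 / stable_sigma k =
   [~ (stable_sigma k * stable_sigma k.+1)^-1, (stable_sigma k)^-1])%g.
  by rewrite commgEl conjgE !invgK !invgM !mulgA stable_sigma_braid !mulgK.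
exact: commutator_comm.
Qed.

(** Modulo commutators all generators agree with the first one, so every braid
    is congruent to a power of it, whose exponent the exponent sum detects. The
    integer exponent is kept as a difference of naturals, natural powers being
    the ones with a convenient calculus in a group. *)
Lemma stable_braid_commutator_sigma0 x : exists a b : nat,
  exponent_sum x = a%:Z - b%:Z /\
  commutator_subgroup (x / (stable_sigma 0 ^+ a / stable_sigma 0 ^+ b))%g.
Proof.
set s := stable_sigma 0.
elim/stable_braid_ind: x =>
  [|x y [a [b [Ex Nx]]] [c [d [Ey Ny]]]|x [a [b [Ex Nx]]]|k].
- exists 0, 0; rewrite exponent_sum1; split=> //.
  by rewrite !expg0 invg1 mulg1 invg1 mulg1; exact: commutator_one.
- exists (a + c)%N, (b + d)%N; rewrite exponent_sumM Ex Ey; split.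
    by rewrite !PoszD opprD addrACA.
  have cs (i j : nat) : commute (s ^+ i)%g (s ^+ j)%g by exact: commuteX2.
  have -> : (s ^+ (a + c) / s ^+ (b + d) =
             (s ^+ a / s ^+ b) * (s ^+ c / s ^+ d))%g.
    rewrite !expgnDr (cs b d) invgM -!mulgA; congr (_ * _)%g; rewrite !mulgA.
    congr (_ / _)%g; exact/commuteV/cs.
  move: (s ^+ a / s ^+ b)%g (s ^+ c / s ^+ d)%g Nx Ny => p r Nx Ny.
  rewrite invgM (_ : _ * _ = (x / p) * (y / r) ^ (p^-1))%g.
    by apply: commutator_mul => //; exact: commutator_conj.
  by rewrite conjgE invgK !mulgA mulgVK.
- exists b, a; split; first by rewrite exponent_sumV Ex opprB.
  have -> : (x^-1 / (s ^+ b / s ^+ a) =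
    ((x / (s ^+ a / s ^+ b))^-1) ^ x)%g.
    by rewrite conjgE [(x / _)^-1%g]invgF mulgVK [(s ^+ b / _)^-1%g]invgF.
  by apply: commutator_conj; apply: commutator_inv.
- exists 1, 0; rewrite exponent_sum_sigma; split=> //.
  by rewrite expg0 invg1 mulg1 expg1; exact: stable_sigma_commutator.
Qed.

(** The only delicate point is that a braid with exponent sum zero is a product
    of commutators: by [stable_braid_commutator_sigma0] it is congruent to the
    zeroth power of a generator. *)
Lemma exponent_sum_abelianization : is_abelianization exponent_sum.
Proof.
have VM x y : exponent_sum [~ x, y]%g = 0.
  rewrite commgEl conjgE !exponent_sumM !exponent_sumV.
  move: (exponent_sum x) (exponent_sum y) => a b.
  by rewrite [a + b]addrC addKr addNr.
split=> [||x].
- exact: exponent_sumM.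
- case=> k; first exists (stable_sigma 0 ^+ k)%g.
    elim: k => [|k IHk]; first by rewrite expg0 exponent_sum1.
    by rewrite expgS exponent_sumM IHk exponent_sum_sigma.
  exists (stable_sigma 0 ^- k.+1)%g; rewrite exponent_sumV NegzE; congr (- _).
  elim: k => [|k IHk]; first by rewrite expg1 exponent_sum_sigma.
  by rewrite expgS exponent_sumM IHk exponent_sum_sigma.
- split=> [x0|].
    have [a [b [Ex]]] := stable_braid_commutator_sigma0 x.
    have /eqP : a%:Z - b%:Z = 0 by rewrite -Ex.
    by rewrite subr_eq0 => /eqP[->]; rewrite mulgV divg1.
  elim=> {x} [x y||x y _ Ex _ Ey|x _ Ex].
  - exact: VM.
  - exact: exponent_sum1.
  - by rewrite exponent_sumM Ex Ey.
  - by rewrite exponent_sumV Ex oppr0.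
Qed.

(** * Finite dimensional representations *)

(** The dimensions of the spans of initial segments are bounded; a segment whose
    span has the largest dimension already spans every term. *)
Lemma span_mkseq_stable (F : fieldType) (V : vectType F) (v : nat -> V) :
  exists K, forall j, v j \in <<mkseq v K>>%VS.
Proof.
pose P d := `[< exists K, \dim <<mkseq v K>> = d >].
have exP : exists d, P d.
  by exists (\dim <<mkseq v 0>>); apply/asboolP; exists 0.
have ubP d : P d -> (d <= \dim {:V})%N.
  by move=> /asboolP[K <-]; exact/dimvS/subvf.
have [d /asboolP[K dK] dmax] := ex_maxnP exP ubP.
exists K => j.
have sub L : (K <= L)%N -> (<<mkseq v K>> <= <<mkseq v L>>)%VS.
  move=> KL; apply/sub_span => _ /mapP[i + ->].
  rewrite mem_iota add0n => /= iK.
  by apply/map_f; rewrite mem_iota (leq_trans iK).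
have KL : (K <= maxn K j.+1)%N by exact: leq_maxl.
suff -> : <<mkseq v K>>%VS = <<mkseq v (maxn K j.+1)>>%VS.
  by apply/memv_span/map_f; rewrite mem_iota add0n leq_maxr.
apply/eqP; rewrite eqEdim sub //= dK; apply: dmax.
by apply/asboolP; exists (maxn K j.+1).
Qed.

Section FiniteDimensional.
Variables (C : numClosedFieldType) (n : nat).
Variable rho : {multiplicative stable_braid -> GL C n}.

(** Take K such that the matrices of the first K generators span those of all
    generators. The generator of index K + 1 is far from the first K ones, so it
    commutes with that span, hence with everything. *)
Lemma central_sigma :
  exists k, forall j, commute (rho (stable_sigma k)) (rho (stable_sigma j)).
Proof.
pose A j : 'M[C]_n := rho (stable_sigma j).
have [K KP] := span_mkseq_stable A.
exists K.+1 => j; apply: val_inj; change (A K.+1 *m A j = A j *m A K.+1).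
have /coord_span -> : A j \in <<in_tuple (mkseq A K)>>%VS by exact: KP.
rewrite mulmx_sumr mulmx_suml; apply: eq_bigr => i _.
have iK : (i < K)%N by move: (ltn_ord i); rewrite {2}size_mkseq.
rewrite -scalemxAr -scalemxAl nth_mkseq //; congr (_ *: _).
have far := stable_sigma_far (iK : i.+1 < K.+1)%N.
by have /(congr1 val) /= <- := gmulf_commute rho far.
Qed.

(** The generators are conjugate to one another and one of them is central in
    the image, so they all have the same image. This is where finite dimension
    and infinitely many strands play against each other. *)
Lemma stable_braid_rep_commute x y : commute (rho x) (rho y).
Proof.
have [k kP] := central_sigma.
have kC x' : commute (rho (stable_sigma k)) (rho x').
  elim/stable_braid_ind: x' => [|x' y' cx cy|x' cx|j].
  - by rewrite hom1; exact: commute1.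
  - by rewrite gmulfM; apply: commuteM.
  - by rewrite homV; apply: commuteV.
  - exact: kP.
have sk : forall j, exists g, stable_sigma j = (stable_sigma 0 ^ g)%g.
  elim=> [|j [g Eg]]; first by exists 1%g; rewrite conjg1.
  by rewrite stable_sigma_conj; eexists; rewrite {1}Eg -conjgM.
have sE j : rho (stable_sigma j) = rho (stable_sigma k).
  have [g Eg] := sk j; have [h Eh] := sk k.
  have -> : stable_sigma j = (stable_sigma k ^ (h^-1 * g))%g.
    by rewrite Eg Eh conjgM conjgK.
  by rewrite homJ; apply/conjg_fixP/commgP/kC.
elim/stable_braid_ind: x => [|x1 x2 c1 c2|x1 c1|j].
- by rewrite hom1; exact/commute_sym/commute1.
- by rewrite gmulfM; apply/commute_sym/commuteM; exact/commute_sym.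
- by rewrite homV; apply/commute_sym/commuteV/commute_sym.
- by rewrite sE.
Qed.

End FiniteDimensional.

Lemma eq_exponent_sum_hom (G : groupType)
    (f : {multiplicative stable_braid -> G}) :
  (forall x y, commute (f x) (f y)) ->
  forall x y, exponent_sum x = exponent_sum y -> f x = f y.
Proof.
move=> cf x y Exy; apply: divg1_eq; rewrite -homV -gmulfM.
apply: hom_commutator => //.
have [_ _ <-] := exponent_sum_abelianization.
by rewrite exponent_sumM exponent_sumV Exy subrr.
Qed.

(** The map on the integers is the given homomorphism precomposed with a section
    of the exponent sum, which may be any set-theoretic section since the
    homomorphism depends on the exponent sum alone. *)
Lemma abelian_hom_exponent_sum (G : groupType)
    (f : {multiplicative stable_braid -> G}) :
  (forall x y, commute (f x) (f y)) ->
  exists phi : int -> G, (forall a b, phi (a + b) = (phi a * phi b)%g) /\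
    forall x, f x = phi (exponent_sum x).
Proof.
move=> cf; have [EM surj _] := exponent_sum_abelianization.
have [s sK] := choice surj.
exists (f \o s); split=> [a b|x] /=.
  by rewrite -gmulfM; apply: eq_exponent_sum_hom => //; rewrite EM !sK.
by apply: eq_exponent_sum_hom => //; rewrite sK.
Qed.

(** All generators act by the same matrix, so an eigenvector of that matrix spans
    a line invariant under the whole stable braid group; irreducibility over
    some finite number of strands forces this line to be everything. *)
Lemma irreducible_rep_dim_le1 (C : numClosedFieldType) (n m : nat)
    (rho : {multiplicative stable_braid -> GL C n}) :
  irreducible_rep (fun x : braid m => rho (stable_braid_in x)) -> (n <= 1)%N.
Proof.
case=> n0 irr.
have [v v0 vs] : exists2 v : 'cV[C]_n, v != 0 &
    exists c, rho (stable_sigma 0) *m v = c *: v.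
  have [c /eigenvalueP[u uE u0]] :=
    eigenvalue_closed ((rho (stable_sigma 0) : 'M[C]_n)^T) n0.
  exists u^T; first by rewrite trmx_eq0.
  by exists c; rewrite -[X in X *m _]trmxK -trmx_mul uE linearZ.
have vP b : exists c, rho b *m v = c *: v.
  elim/stable_braid_ind: b => [|x y [c cE] [d dE]|x [c cE]|k].
  - by exists 1; rewrite hom1 scale1r mul1mx.
  - by exists (c * d); rewrite gmulfM -mulmxA dE -scalemxAr cE scalerA mulrC.
  - exists c^-1; rewrite homV /=.
    (* An eigenvalue of an invertible matrix is nonzero. *)
    have vE : v = c *: (invmx (rho x) *m v).
      by rewrite scalemxAr -cE mulmxA mulVmx ?mul1mx ?GLmxP.
    have c0 : c != 0 by apply: contra_neq v0 => c0; rewrite vE c0 scale0r.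
    by rewrite {2}vE scalerA mulVf ?scale1r.
  - have -> : rho (stable_sigma k) = rho (stable_sigma 0); last by [].
    apply: (eq_exponent_sum_hom (@stable_braid_rep_commute _ _ rho)).
    by rewrite !exponent_sum_sigma.
have Wstab (b : braid m) u :
    u \in <[v]>%VS -> rho (stable_braid_in b) *m u \in <[v]>%VS.
  move=> /vlineP[c ->]; have [d dP] := vP (stable_braid_in b).
  by rewrite -scalemxAr dP; apply/rpredZ/rpredZ/memv_line.
case: (irr _ Wstab) => [W0|full].
  by have := memv_line v; rewrite W0 memv0 (negPf v0).
by have := dim_vline v; rewrite full dimvf /dim /= v0 muln1 => ->.
Qed.

Local Open Scope classical_set_scope.

(** * Homotopies *)

Lemma continuous_pair (X Y Z : topologicalType) (f : X -> Y) (g : X -> Z) :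
  continuous f -> continuous g -> continuous (fun x => (f x, g x)).
Proof.
by move=> cf cg x; apply: (@cvg_pair _ _ _ (nbhs x) (nbhs (f x)) (nbhs (g x)));
  [exact: cf|exact: cg].
Qed.

Lemma continuous_compT (X Y Z : topologicalType) (f : X -> Y) (g : Y -> Z) :
  continuous f -> continuous g -> continuous (g \o f).
Proof. by move=> cf cg x; apply: continuous_comp; [exact: cf|exact: cg]. Qed.

Lemma eq_within_continuous (T S : topologicalType) (A : set T) (f g : T -> S) :
  {in A, f =1 g} -> {within A, continuous f} -> {within A, continuous g}.
Proof.
exact: (@subspace_eq_continuous _ A _ (from_subspace A f) (from_subspace A g)).
Qed.

Section Homotopies.
Variable R : realType.

(** A retraction of the line onto the unit interval. Composing the time parameter
    with it turns a homotopy continuous on the unit interval only into one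
    continuous on the whole line, and keeps interpolation weights nonnegative. *)
Definition clamp (s : R) : R := Num.max 0 (Num.min 1 s).

Lemma clamp_itv s : 0 <= clamp s <= 1.
Proof. by rewrite /clamp le_max lexx /= ge_max ler01 ge_min lexx. Qed.

Lemma clamp0 : clamp 0 = 0.
Proof. by rewrite /clamp min_r ?ler01 // maxxx. Qed.

Lemma clamp1 : clamp 1 = 1.
Proof. by rewrite /clamp minxx max_r ?ler01. Qed.

Lemma continuous_clamp : continuous clamp.
Proof.
move=> s; apply: continuous_max; first exact: cvg_cst.
apply: continuous_min; first exact: cvg_cst.
exact: cvg_id.
Qed.

Variables X Y : topologicalType.

(** Homotopies may be taken continuous for all real times, which frees the later
    constructions from the subspace topology. *)
Lemma homotopicP (f g : X -> Y) : homotopic R f g <->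
  exists H : X * R -> Y, [/\ continuous H,
    forall x, H (x, 0) = f x & forall x, H (x, 1) = g x].
Proof.
split=> -[H [Hc H0 H1]]; last first.
  by exists H; split=> //; exact: continuous_subspaceT.
exists (fun p => H (p.1, clamp p.2)).
split=> [p|x|x]; rewrite ?clamp0 ?clamp1 //.
have /subspace_continuousP/(_ (p.1, clamp p.2) (clamp_itv _)) Hp := Hc.
apply: (cvg_comp (fun q => (q.1, clamp q.2)) H _ Hp).
have /(_ p) cc : continuous (fun q : X * R => (q.1, clamp q.2)).
  apply: continuous_pair => q; first exact: cvg_fst.
  by apply: (cvg_comp snd clamp); [exact: cvg_snd|exact: continuous_clamp].
move=> U wU; apply: (@filterS _ (nbhs p) _ _ _ _ (cc _ wU)) => q /=; apply.
exact: clamp_itv.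
Qed.

(** The usual concatenation at double speed, continuous by the pasting lemma on
    the two closed halves of the cylinder. *)
Lemma homotopic_trans (f g h : X -> Y) :
  homotopic R f g -> homotopic R g h -> homotopic R f h.
Proof.
move=> /homotopicP[H [Hc H0 H1]] /homotopicP[K [Kc K0 K1]].
apply/homotopicP.
exists (fun p =>
  if p.2 <= 1/2 then H (p.1, 2 * p.2) else K (p.1, 2 * p.2 - 1)).
split=> [|x|x] /=; last 2 first.
- by rewrite divr_ge0 // mulr0.
- have -> : (1 <= 1 / 2 :> R) = false.
    by apply: negbTE; rewrite -ltNge ltr_pdivrMr ?mul1r ?ltr1n.
  by rewrite mulr1 (_ : 2 - 1 = 1 :> R) ?K1 // -[2]natr1 addrK.
have Lc : closed [set p : X * R | p.2 <= 1/2].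
  apply: (@preimage_closed _ _ (@snd X R) [set t | t <= 1/2]).
    by move=> p _; exact: cvg_snd.
  exact: closed_le.
have Rc : closed [set p : X * R | 1/2 <= p.2].
  apply: (@preimage_closed _ _ (@snd X R) [set t | 1/2 <= t]).
    by move=> p _; exact: cvg_snd.
  exact: closed_ge.
have c2 (b : R) : continuous (fun p : X * R => (p.1, 2 * p.2 - b)).
  apply: continuous_pair => p; first exact: cvg_fst.
  apply: cvgB; last exact: cvg_cst.
  by apply: cvgM; [exact: cvg_cst|exact: cvg_snd].
apply/continuous_subspace_setT.
have -> : [set: X * R] = [set p | p.2 <= 1/2] `|` [set p | 1/2 <= p.2].
  apply/seteqP; split=> // p _.
  by case: (leP p.2 (1/2)) => [|/ltW]; [left|right].
apply: withinU_continuous => //.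
  apply: (@eq_within_continuous _ _ _ (fun p : X * R => H (p.1, 2 * p.2 - 0))).
    by move=> p; rewrite inE /= => p1; rewrite ifT // subr0.
  exact: continuous_subspaceT (continuous_compT (c2 0) Hc).
apply: (@eq_within_continuous _ _ _ (fun p : X * R => K (p.1, 2 * p.2 - 1))).
  move=> p; rewrite inE /= => p1; case: ifP => // p2.
  (* On the overlap both formulas give the common endpoint g. *)
  have -> : p.2 = 1/2 by apply: le_anti; rewrite p2.
  by rewrite mulrC divfK ?pnatr_eq0 // subrr K0 -H1.
exact: continuous_subspaceT (continuous_compT (c2 1) Kc).
Qed.

End Homotopies.

Lemma homotopic_postcomp (R : realType) (X Y Z : topologicalType) (k : Y -> Z)
    (f g : X -> Y) :
  continuous k -> homotopic R f g -> homotopic R (k \o f) (k \o g).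
Proof.
move=> kc /homotopicP[H [Hc H0 H1]]; apply/homotopicP; exists (k \o H).
by split=> [|x|x] /=; rewrite ?H0 ?H1 //; exact: continuous_compT.
Qed.

Lemma homotopic_precomp (R : realType) (X Y Z : topologicalType) (k : X -> Y)
    (f g : Y -> Z) :
  continuous k -> homotopic R f g -> homotopic R (f \o k) (g \o k).
Proof.
move=> kc /homotopicP[H [Hc H0 H1]]; apply/homotopicP.
exists (H \o (fun p => (k p.1, p.2))).
split=> [|x|x] /=; rewrite ?H0 ?H1 //; apply: continuous_compT => //.
apply: continuous_pair => p; last exact: cvg_snd.
by apply: (cvg_comp fst k); [exact: cvg_fst|exact: kc].
Qed.

(** * The infinite join and the classifying space *)

Section Join.
Variables (R : realType) (G : topGroupType).

Lemma subbase_open (A : set (join_data R G)) : join_subbase A -> open A.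
Proof.
move=> jA; exists [set A]; last by rewrite bigcup_set1.
move=> _ ->.
exists [fset A]%fset; first by move=> B; move=> /fset1P ->; exact/mem_set.
by rewrite set_fset1 bigcap_set1.
Qed.

(** Unfolds the topology generated by the subbase: every open set is a union of
    finite intersections of subbasic sets. *)
Lemma join_open_elim (W : set (join_data R G)) x : open W -> W x ->
  exists2 A : {fset (set (join_data R G))},
    (forall B, B \in A -> join_subbase B /\ B x) &
    forall y, (forall B, B \in A -> B y) -> W y.
Proof.
move=> [D' sD' <-] [A D'A Ax].
have [E sE AE] := sD' _ D'A.
exists E => [B BE|y yE].
  split; first exact/set_mem/sE.
  by move: Ax; rewrite -AE; apply.
by exists A => //; change (A y); rewrite -AE => B BE; exact: yE.
Qed.

(** The universal property of the coarsest topology: continuity into the join is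
    tested on the barycentric coordinates and, where they are positive, on the
    labels. *)
Lemma continuous_join (S : topologicalType) (f : S -> join_data R G) :
  (forall i, continuous (fun s => jweight (f s) i)) ->
  (forall i (V : set G), open V ->
    open [set s | 0 < jweight (f s) i /\ V (jlabel (f s) i)]) ->
  continuous f.
Proof.
move=> cw cl s W; rewrite nbhsE => -[W' [oW' W's] sW].
have [A Ax AW] := join_open_elim oW' W's.
have : nbhs s (\bigcap_(B in [set` A]) f @^-1` B).
  apply: filter_bigI => B BA; have [jB Bs] := Ax B BA.
  apply: open_nbhs_nbhs; split => //.
  case: jB => [[i [V [oV BE]]]|[i [V [oV BE]]]]; rewrite BE.
    by apply: (open_comp _ oV) => t _; exact: cw.
  exact: cl.
by apply: filterS => t tA; apply/sW/AW => B BA; exact: tA.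
Qed.

(** A label over a vanishing weight is not seen by any subbasic set. Hence open
    sets are already saturated for the first of the two identifications made in
    the quotient [BG]. *)
Lemma join_open_indiscernible (x y : join_data R G)
    (W : set (join_data R G)) :
  jweight x = jweight y ->
  (forall i, 0 < jweight x i -> jlabel x i = jlabel y i) ->
  open W -> W x -> W y.
Proof.
move=> w l oW Wx; have [A Ax AW] := join_open_elim oW Wx.
apply: AW => B BA; have [[[i [V [oV BE]]]|[i [V [oV BE]]]]] := Ax B BA.
  by rewrite BE /= w.
by rewrite BE /= -w => -[wi]; rewrite l.
Qed.

Lemma continuous_jweight i : continuous (fun x : join_data R G => jweight x i).
Proof. by apply/continuousP => V oV; apply: subbase_open; left; exists i, V. Qed.

Lemma open_jlabel i (V : set G) : open V ->
  open [set x : join_data R G | 0 < jweight x i /\ V (jlabel x i)].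
Proof. by move=> oV; apply: subbase_open; right; exists i, V. Qed.

End Join.

Section Classifying.
Variables (R : realType) (G : topGroupType).

Lemma continuous_BG_pi : continuous (@BG_pi R G).
Proof. exact: pi_continuous. Qed.

Lemma BG_pi_surj (x : BG R G) : exists y, x = BG_pi y.
Proof. by exists (repr x); rewrite /BG_pi reprK. Qed.

Hypothesis mulr_continuous : forall g : G, continuous (fun h : G => (h * g)%g).

Definition join_translate (g : G) (x : join_data R G) : join_data R G :=
  JoinData (fun i => (jlabel x i * g)%g) (jweightP x).

Lemma continuous_join_translate g : continuous (join_translate g).
Proof.
apply: continuous_join => [i|i V oV]; first exact: continuous_jweight.
apply: (@open_jlabel R G i [set h | V (h * g)%g]).
by apply: (open_comp _ oV) => h _; exact: mulr_continuous.
Qed.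

Lemma BG_pi_translate g x : BG_pi (join_translate g x) = BG_pi x.
Proof.
by apply/esym/BG_piP/asboolP; split=> //; exists g.
Qed.

(** The saturation of an open set is the union of its translates, because the
    identification of irrelevant labels adds nothing to an open set; translations
    being continuous, it is open. *)
Lemma open_map_BG_pi (W : set (join_data R G)) :
  open W -> open (@BG_pi R G @` W).
Proof.
move=> oW; change (open (@BG_pi R G @^-1` (@BG_pi R G @` W))).
have -> : @BG_pi R G @^-1` (@BG_pi R G @` W) =
    \bigcup_g (join_translate g @^-1` W).
  apply/seteqP; split=> [y [x Wx /BG_piP/asboolP[w [g gP]]]|y [g _ Wy]].
    (* Translating back, the labels agree with those of x where they matter. *)
    exists g^-1%g => //; apply: (join_open_indiscernible _ _ oW Wx) => //.
    by move=> i wi; rewrite /= gP // mulgK.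
  by exists (join_translate g y) => //; exact: BG_pi_translate.
apply: bigcup_open => g _; apply: open_comp oW => x _.
exact: continuous_join_translate.
Qed.

(** A product of a quotient map with a space need not be a quotient map, but it
    is one when the quotient map is open. This lets homotopies be defined on the
    join and descend to the classifying space. *)
Lemma continuous_BG_prod (S Y : topologicalType) (F : BG R G * S -> Y) :
  continuous (fun p : join_data R G * S => F (BG_pi p.1, p.2)) -> continuous F.
Proof.
move=> Fc [z s] W /= nW; have [x zx] := BG_pi_surj z; subst z.
have [[A B] /= [nA nB] AB] := Fc (x, s) W nW.
have {}nA : nbhs (BG_pi x) (@BG_pi R G @` A).
  move: nA; rewrite nbhsE => -[A' [oA' A'x] sA].
  apply: (@filterS _ (nbhs (BG_pi x)) _ (@BG_pi R G @` A')).
    exact: image_subset.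
  by apply: open_nbhs_nbhs; split; [exact: open_map_BG_pi|exists x].
exists (@BG_pi R G @` A, B) => // -[_ t] [/= [y Ay <-] Bt].
exact: (AB (y, t)).
Qed.

End Classifying.

(** * Maps out of the classifying space of a discrete group *)

Section Discrete.
Variables (R : realType) (G H : topGroupType).
Hypothesis discG : forall A : set G, open A.

Lemma continuous_discrete (Y : topologicalType) (f : G -> Y) : continuous f.
Proof. by apply/continuousP. Qed.

(** A path of homomorphisms moves only the labels. Since G is discrete, the set
    where a label lies in V at time s splits over the values g of the original
    label into products of an open set of the join and an open set of times. *)
Lemma continuous_BG_map_family (psi : R -> {multiplicative G -> H}) :
  (forall g, continuous (fun s => psi s g)) ->
  continuous (fun p : BG R G * R => BG_map (psi p.2) p.1).
Proof.
move=> psic; apply: continuous_BG_prod => [g|]; first exact: continuous_discrete.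
have -> : (fun p : join_data R G * R => BG_map (psi p.2) (BG_pi p.1)) =
    @BG_pi R H \o (fun p => join_map (psi p.2) p.1).
  by apply/funext => p; rewrite BG_mapE.
apply: continuous_compT; last exact: continuous_BG_pi.
apply: continuous_join => [i|i V oV] /=.
  apply: (@continuous_compT _ _ _ fst (fun x : join_data R G => jweight x i)).
    by move=> p; exact: cvg_fst.
  exact: continuous_jweight.
rewrite [X in open X](_ : _ = \bigcup_g
    ((fst @^-1` [set x : join_data R G |
        0 < jweight x i /\ [set g] (jlabel x i)])
     `&` (snd @^-1` [set s | V (psi s g)]))).
  apply: bigcup_open => g _; apply: openI.
    apply: open_comp; last exact: open_jlabel.
    by move=> p _; exact: cvg_fst.
  apply: open_comp; first by move=> p _; exact: cvg_snd.
  by apply: (open_comp _ oV) => s _; exact: psic.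
apply/seteqP; split=> [p [wi Vp]|p [g _ [[wi gE] Vp]]].
  by exists (jlabel p.1 i).
by split=> //; move: gE => /= ->.
Qed.

Lemma continuous_BG_map (f : {multiplicative G -> H}) :
  continuous (BG_map f : BG R G -> BG R H).
Proof.
have fc : continuous (fun p : BG R G * R => BG_map f p.1).
  by apply: (@continuous_BG_map_family (fun=> f)) => g; exact: cst_continuous.
have pc : continuous (fun x : BG R G => (x, 0 : R)).
  by apply: continuous_pair => [x|]; [exact: cvg_id|exact: cst_continuous].
exact: continuous_compT pc fc.
Qed.

Lemma homotopic_BG_map (psi : R -> {multiplicative G -> H}) :
  (forall g, continuous (fun s => psi s g)) ->
  homotopic R (BG_map (psi 0)) (BG_map (psi 1) : BG R G -> BG R H).
Proof.
move=> psic; apply/homotopicP.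
exists (fun p => BG_map (psi p.2) p.1); split=> //.
exact: continuous_BG_map_family.
Qed.

Definition vertex_weight (i : nat) : R := (i == 0)%:R.

Lemma interpolate_weightsP (s : R) (t : nat -> R) :
  0 <= s <= 1 -> simplex_weights t ->
  simplex_weights (fun i => (1 - s) * t i + s * vertex_weight i).
Proof.
move=> /andP[s0 s1] [t0 [N [tN sN]]]; split=> [i|].
  by rewrite addr_ge0 // mulr_ge0 // ?subr_ge0 // /vertex_weight ler0n.
(* One more vertex than N, so that the first vertex is counted even if N = 0. *)
exists N.+1; split=> [[|i] iN|]; rewrite /vertex_weight //.
  by rewrite tN ?mulr0 ?addr0 // ltnW.
rewrite big_split /= -!mulr_sumr big_ord_recr /= sN tN // addr0.
by rewrite big_ord_recl /= big1 ?addr0 // ?mulr1 ?subrK.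
Qed.

(** The straight line from the weights of a point to the first vertex, in the
    part of the join with trivial labels. *)
Definition contract_join (p : join_data R G * R) : join_data R H :=
  JoinData (fun=> 1%g) (interpolate_weightsP (clamp_itv p.2) (jweightP p.1)).

(** With all labels equal to one, the image lies in the simplex of barycentric
    weights, which is contracted linearly onto its first vertex. *)
Lemma BG_map_trivial (f : {multiplicative G -> H}) :
  (forall g, f g = 1%g) ->
  homotopic R (BG_map f) (fun _ : BG R G => BG_point : BG R H).
Proof.
move=> f1; apply/homotopicP.
exists (fun p => BG_pi (contract_join (repr p.1, p.2))).
have jc : continuous contract_join.
  have cwc i : continuous (fun p => jweight (contract_join p) i).
    have cc : continuous (fun p : join_data R G * R => clamp p.2).
      apply: (@continuous_compT _ _ _ snd); last exact: continuous_clamp.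
      by move=> p; exact: cvg_snd.
    have wc : continuous (fun p : join_data R G * R => jweight p.1 i).
      apply: (@continuous_compT _ _ _ fst (fun x : join_data R G => jweight x i)).
        by move=> p; exact: cvg_fst.
      exact: continuous_jweight.
    move=> p; apply: cvgD; apply: cvgM; last exact: cvg_cst.
    - by apply: cvgB; [exact: cvg_cst|exact: cc].
    - exact: wc.
    - exact: cc.
  apply: continuous_join => // i V oV.
  have [V1|V1] := pselect (V 1%g); last first.
    rewrite [X in open X](_ : _ = set0); first exact: open0.
    by apply/seteqP; split=> // p [].
  rewrite [X in open X](_ : _ =
      (fun p => jweight (contract_join p) i) @^-1` [set t | 0 < t]).
    by apply: open_comp; [move=> p _; exact: cwc|exact: open_gt].
  by apply/seteqP; split=> p // [].
have BE x s : BG_pi (contract_join (repr (BG_pi x), s)) =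
              BG_pi (contract_join (x, s)).
  have /BG_piP/asboolP[w _] : BG_pi (repr (BG_pi x)) = BG_pi x.
    by rewrite /BG_pi reprK.
  apply/BG_piP/asboolP; split; first by rewrite /= w.
  by exists 1%g => i _; rewrite /= mulg1.
split.
- apply: continuous_BG_prod => [g|]; first exact: continuous_discrete.
  rewrite (_ : (fun _ => _) = @BG_pi R H \o contract_join).
    by apply: continuous_compT => //; exact: continuous_BG_pi.
  by apply/funext => -[x s] /=; rewrite BE.
- move=> z; have [x ->] := BG_pi_surj z; rewrite BE BG_mapE.
  apply/BG_piP/asboolP; split.
    by apply/funext => i /=; rewrite clamp0 subr0 mul1r mul0r addr0.
  by exists 1%g => i _; rewrite /= f1 mulg1.
- move=> z; have [x ->] := BG_pi_surj z; rewrite BE.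
  apply/BG_piP/asboolP; split.
    by apply/funext => i /=; rewrite clamp1 subrr mul1r mul0r add0r.
  by exists 1%g => i _; rewrite /= mulg1.
Qed.

End Discrete.

Section Stabilization.
Variable R : realType.
Local Notation C := (R[i] : numClosedFieldType).

Lemma continuous_BU_in n : continuous (@BU_in R n).
Proof.
apply: (@continuous_compT _ _ _ (existT (fun n => BG R (U C n)) n)).
  exact: existT_continuous.
exact: pi_continuous.
Qed.

(** Stabilization preserves the unit matrix, hence the base point. *)
Lemma BU_in_point n : BU_in (BG_point : BG R (U C n)) = BU_point R.
Proof.
elim: n => [//|n <-].
rewrite -[RHS](colim_in_step (BU_stab (R:=R))); congr (colim_in _ _).
rewrite /BU_stab BG_mapE; apply/BG_piP/asboolP; split=> //.
by exists (U_stab 1%g) => i _; rewrite /= mul1g.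
Qed.

End Stabilization.

(** * One-parameter groups of unitary matrices *)

Section CircleExponential.
Variable R : realType.
Local Notation C := (R[i] : numClosedFieldType).

(** The complex exponential of i t. *)
Definition cis (t : R) : C := (cos t +i* sin t)%C.

Lemma cisD s t : cis (s + t) = cis s * cis t.
Proof. by rewrite /cis cosD sinD; simpc; rewrite [sin s * cos t + _]addrC. Qed.

Lemma cis0 : cis 0 = 1.
Proof. by rewrite /cis cos0 sin0. Qed.

Lemma norm_cis t : `|cis t| = 1.
Proof. by rewrite normc_def /= cos2Dsin2 sqrtr1. Qed.

Lemma cis_surj (z : C) : `|z| = 1 -> exists t, z = cis t.
Proof.
case: z => a b; rewrite normc_def => /(congr1 (@complex.Re R)) /= ab1.
have {}ab1 : a ^+ 2 + b ^+ 2 = 1.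
  by rewrite -(sqr_sqrtr (addr_ge0 (sqr_ge0 a) (sqr_ge0 b))) ab1 expr1n.
have aB : -1 <= a <= 1.
  rewrite -ler_norml -(@expr_le1 _ 2) // -normrX ger0_norm ?sqr_ge0 //.
  by rewrite -ab1 lerDl sqr_ge0.
have b2 : sin (acos a) = `|b|.
  by rewrite sin_acos // -ab1 addrC addKr sqrtr_sqr.
have [b0|b0] := leP 0 b; [exists (acos a)|exists (- acos a)].
  by rewrite /cis acosK // b2 ger0_norm.
by rewrite /cis cosN sinN acosK // b2 ltr0_norm // opprK.
Qed.

(** A positive element of the complex numbers is real, so the balls restrict to
    the real ones. *)
Lemma continuous_real_complex : continuous (fun t : R => t%:C%C : C).
Proof.
move=> t; apply/cvgrPdist_lt => -[e i]; rewrite ltcE /= => /andP[/eqP -> e0].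
have /cvgrPdist_lt /(_ e e0) := @cvg_id _ (nbhs t).
apply: filterS => s ts; rewrite -rmorphB /= normc_def /= expr0n addr0 sqrtr_sqr.
by rewrite ltcR.
Qed.

Lemma continuous_cis : continuous cis.
Proof.
have -> : cis = fun t => (cos t)%:C%C + 'i * (sin t)%:C%C.
  by apply/funext => t; rewrite /cis; apply/eqP; rewrite eq_complex /=; simpc.
move=> t; apply: cvgD.
  apply: (continuous_compT _ continuous_real_complex); exact: continuous_cos.
apply: cvgM; first exact: cvg_cst.
apply: (continuous_compT _ continuous_real_complex); exact: continuous_sin.
Qed.

End CircleExponential.

Section OneParameterGroups.
Variables (R : realType) (n : nat).
Local Notation C := (R[i] : numClosedFieldType).

Lemma diag_mx_unitaryP (d : 'rV[C]_n) :
  diag_mx d \is unitarymx <-> forall j, `|d 0 j| = 1.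
Proof.
rewrite -(rwP unitarymxP) tr_diag_mx map_diag_mx mulmx_diag -diag_const_mx.
split=> [/matrixP E j|E].
  have := E j j; rewrite !mxE eqxx /= !mulr1n -normCK => /eqP.
  by rewrite sqrp_eq1 ?normr_ge0 // => /eqP.
by congr diag_mx; apply/rowP => j; rewrite !mxE -normCK E expr1n.
Qed.

(** The one-parameter group s |-> exp (i s H), where H is the matrix that is
    diagonal with eigenvalues th in the basis formed by the rows of P. *)
Definition unitary_flow (P : 'M[C]_n) (th : 'I_n -> R) (s : R) : 'M[C]_n :=
  invmx P *m diag_mx (\row_j cis (s * th j)) *m P.

Lemma unitary_flow_unitary P th s :
  P \is unitarymx -> unitary_flow P th s \is unitarymx.
Proof.
move=> PU; rewrite !mul_unitarymx //.
  by rewrite invmx_unitary // trmxC_unitary.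
by apply/diag_mx_unitaryP => j; rewrite mxE norm_cis.
Qed.

Lemma unitary_flowD P th s t : P \in unitmx ->
  unitary_flow P th (s + t) = unitary_flow P th s *m unitary_flow P th t.
Proof.
move=> PU; rewrite /unitary_flow -!mulmxA (mulmxA P) mulmxV // mul1mx.
rewrite !mulmxA -[_ *m diag_mx _ *m diag_mx _]mulmxA mulmx_diag.
congr (_ *m diag_mx _ *m _); apply/rowP => j.
by rewrite !mxE mulrDl cisD.
Qed.

Lemma unitary_flow0 P th : P \in unitmx -> unitary_flow P th 0 = 1%:M.
Proof.
move=> PU; rewrite /unitary_flow (_ : \row_j _ = const_mx 1).
  by rewrite diag_const_mx mulmx1 mulVmx.
by apply/rowP => j; rewrite !mxE mul0r cis0.
Qed.

Lemma continuous_bigsum (I : Type) (r : seq I) (F : I -> R -> C) :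
  (forall k, continuous (F k)) -> continuous (fun s => \sum_(k <- r) F k s).
Proof.
move=> Fc; elim: r => [|k r IHr] s.
  by under eq_fun do rewrite big_nil; exact: cvg_cst.
under eq_fun do rewrite big_cons.
by apply: cvgD; [exact: Fc|exact: IHr].
Qed.

Lemma continuous_unitary_flow P th : continuous (unitary_flow P th).
Proof.
have entry i j : continuous (fun s => unitary_flow P th s i j).
  have -> : (fun s => unitary_flow P th s i j) =
      fun s => \sum_k (invmx P i k * cis (s * th k)) * P k j.
    apply/funext => s; rewrite mxE; apply: eq_bigr => k _.
    by rewrite mul_mx_diag !mxE.
  apply: continuous_bigsum => k.
  have cisc : continuous (fun s : R => cis (s * th k)).
    apply: (continuous_compT _ (@continuous_cis R)) => t.
    by apply: cvgM; [exact: cvg_id|exact: cvg_cst].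
  move=> s; apply: cvgM; last exact: cvg_cst.
  by apply: cvgM; [exact: cvg_cst|exact: cisc].
move=> s W [E nE sE].
have En : nbhs s (fun t => forall i j, E i j (unitary_flow P th t i j)).
  apply: (@filter_forall _ _ _ (nbhs s)) => i.
  apply: (@filter_forall _ _ _ (nbhs s)) => j.
  exact: (entry i j s _ (nE i j)).
by apply: filterS En => t /=; exact: sE.
Qed.

(** The spectral theorem diagonalizes a unitary matrix in an orthonormal basis,
    with eigenvalues on the unit circle; their arguments give the flow. In other
    words the exponential map of U(n) is onto. *)
Lemma unitary_flow_through (A : 'M[C]_n) : A \is unitarymx ->
  exists P th, P \is unitarymx /\ A = unitary_flow P th 1.
Proof.
move=> AU; have PU := spectral_unitarymx A; set P := spectralmx A in PU.
have PV := unitarymx_unit PU.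
have /orthomx_spectralP AE : A \is normalmx.
  apply/normalmxP; rewrite (unitarymxP AU).
  by have := AU; rewrite -trmxC_unitary => /unitarymxP; rewrite trmxCK => ->.
set d := spectral_diag A in AE; rewrite -/P in AE.
have dU : diag_mx d \is unitarymx.
  have -> : diag_mx d = P *m A *m invmx P.
    by rewrite AE !mulmxA mulmxV // mul1mx mulmxK.
  by rewrite !mul_unitarymx // invmx_unitary // trmxC_unitary.
have /choice[th thE] : forall j, exists t, d 0 j = cis t.
  by move=> j; apply: cis_surj; exact: (diag_mx_unitaryP d).1.
exists P, th; split=> //; rewrite /unitary_flow {1}AE.
by congr (_ *m diag_mx _ *m _); apply/rowP => j; rewrite mxE mul1r thE.
Qed.

End OneParameterGroups.

(** * The class in K-theory *)

Section KClass.
Variables (R : realType) (n : nat).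
Local Notation C := (R[i] : numClosedFieldType).
Variable rho : {multiplicative stable_braid -> GL C n}.
Hypothesis rhoU : unitary_rep rho.

(** A one-parameter group U through the common image of the generators yields,
    for each time s, the homomorphism x |-> U (s e(x)), with e the exponent sum.
    It joins the trivial homomorphism to the given representation. *)
Lemma unitary_rep_deformation :
  exists psi : R -> {multiplicative stable_braid -> U C n},
  [/\ forall x, continuous (fun s => psi s x),
      forall x, psi 0 x = 1%g & forall x, U_GL (psi 1 x) = rho x].
Proof.
have [P [th [PU sE]]] := unitary_flow_through (rhoU (stable_sigma 0)).
have PV := unitarymx_unit PU.
pose f s (x : stable_braid) : U C n :=
  MkU (unitary_flow_unitary th (s * (exponent_sum x)%:~R) PU).
have fM s x y : f s (x * y)%g = (f s x * f s y)%g.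
  apply: val_inj; rewrite /= exponent_sumM rmorphD mulrDr; exact: unitary_flowD.
pose psi s : {multiplicative stable_braid -> U C n} :=
  HB.pack (f s) (isMultiplicative.Build stable_braid (U C n) (f s) (fM s)).
exists psi; split=> x.
- apply: continuous_comp_initial.
  apply: (continuous_compT _ (@continuous_unitary_flow R n P th)) => s.
  by apply: cvgM; [exact: cvg_id|exact: cvg_cst].
- by apply: val_inj; rewrite /= mul0r; exact: unitary_flow0.
- pose g : {multiplicative stable_braid -> GL C n} := @U_GL C n \o psi 1.
  change (g x = rho x); elim/stable_braid_ind: x => [|x y Ex Ey|x Ex|k].
  + by rewrite !hom1.
  + by rewrite !gmulfM Ex Ey.
  + by rewrite !homV Ex.
  + have -> : rho (stable_sigma k) = rho (stable_sigma 0).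
      apply: (eq_exponent_sum_hom (@stable_braid_rep_commute _ _ rho)).
      by rewrite !exponent_sum_sigma.
    by apply: val_inj; rewrite /= exponent_sum_sigma mulr1 sE.
Qed.

(** Since rho factors through U(n), a homotopy inverse of BU(n) -> BGL(n) may be
    replaced by the map induced by the factorization; this map is deformed to the
    one induced by the trivial homomorphism, and then contracted. *)
Lemma unitary_rep_KU_class_trivial : KU_class_trivial rho.
Proof.
have [psi [psic psi0 psi1]] := unitary_rep_deformation.
have discB (A : set stable_braid) : open A by exact: discrete_open.
move=> r [_ rU _].
have mapE : BG_map (R:=R) rho = BG_map (@U_GL C n) \o BG_map (psi 1).
  apply/funext => z; have [x ->] := BG_pi_surj z; rewrite /= !BG_mapE.
  by congr BG_pi; congr JoinData; apply/funext => i; rewrite -psi1.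
have psi1c : continuous (BG_map (R:=R) (psi 1)) by exact: continuous_BG_map.
rewrite /KU_trivial /KU_map mapE.
have BUc := @continuous_BU_in R n.
apply: (homotopic_trans (homotopic_postcomp BUc (homotopic_precomp psi1c rU))).
(* Time is reversed, to run from the representation to the trivial one. *)
have psi'c (g : stable_braid) : continuous (fun s : R => psi (1 - s) g).
  apply: (continuous_compT _ (psic g)) => s.
  by apply: cvgB; [exact: cvg_cst|exact: cvg_id].
have := homotopic_trans (homotopic_BG_map discB psi'c)
  (BG_map_trivial R discB _).
rewrite subr0 subrr => /(_ psi0)/(homotopic_postcomp BUc).
by rewrite -(BU_in_point R n).
Qed.

End KClass.

Theorem proposition1p8 (R : realType) (n : nat)
    (rho : {multiplicative stable_braid -> GL (R[i] : numClosedFieldType) n}) :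
  ((exists m, irreducible_rep (fun x : braid m => rho (stable_braid_in x))) ->
   (2 <= n)%N ->
   (forall b, rho b = 1%g) /\ KU_class_trivial rho)
  /\
  (unitary_rep rho ->
   (exists q : stable_braid -> int, is_abelianization q /\
    exists phi : int -> GL (R[i] : numClosedFieldType) n,
      (forall a b, phi (a + b) = (phi a * phi b)%g) /\
      (forall b, rho b = phi (q b))) /\
   KU_class_trivial rho).
Proof.
split=> [[m /irreducible_rep_dim_le1 n1] n2|rhoU].
  by have := leq_trans n2 n1.
split; last exact: unitary_rep_KU_class_trivial.
exists exponent_sum; split; first exact: exponent_sum_abelianization.
exact/abelian_hom_exponent_sum/stable_braid_rep_commute.
Qed.
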